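(* Suppose that $V_1$ and $V_2$ are free modules of infinite ranks $\varkappa_1$ and $\varkappa_2$ over rings $R_1$ and $R_2$, respectively, that every submodule of the module $V_1$ can be generated by at most $\varkappa_1$ elements, and that every submodule of the module $V_2$ can be generated by at most $\varkappa_2$ elements. Then $\mathrm{End}_{R_1}(V_1)\equiv \mathrm{End}_{R_2}(V_2)$ implies $P(V_1)\equiv P(V_2)$.
   Context: Rings are associative with unit; modules are left modules. $\equiv$ denotes elementary equivalence (the same first order sentences hold). For rings, the language is the first order language of rings. For a module $V$, $P(V)$ is the structure whose elements are all submodules of $V$, with the single binary relation $M\subset N$ (''$M$ is a submodule of $N$''), in the first order language with this relation. *)

(* Defs.v *)
From HB Require Import structures.
From mathcomp Require Import all_boot all_order all_algebra.
From mathcomp Require Import boolp classical_sets functions cardinality.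

Set Implicit Arguments.
Unset Strict Implicit.
Unset Printing Implicit Defensive.

Import GRing.Theory.

Local Open Scope classical_set_scope.

Record signature := Signature {
  fsym : Type;
  farity : fsym -> nat;
  rsym : Type;
  rarity : rsym -> nat }.

(* Terms and formulas are well-scoped: the free variables of an inhabitant of
   [term L n] or [formula L n] are among the n variables indexed by 'I_n. *)
Inductive term (L : signature) (n : nat) : Type :=
| Var of 'I_n
| App (f : fsym L) of ('I_(farity f) -> term L n).

(* A quantifier binds the variable of index 0 of its body; the variable of
   index i.+1 of the body is the variable of index i outside. *)
Inductive formula (L : signature) : nat -> Type :=
| FFalse n : formula L n
| FEq n of term L n & term L n : formula L n
| FRel n (r : rsym L) of ('I_(rarity r) -> term L n) : formula L n
| FImp n of formula L n & formula L n : formula L n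
| FAnd n of formula L n & formula L n : formula L n
| FOr n of formula L n & formula L n : formula L n
| FAll n of formula L n.+1 : formula L n
| FEx n of formula L n.+1 : formula L n.

Definition sentence (L : signature) := formula L 0.

Record structure (L : signature) := Structure {
  carrier :> Type;
  fun_interp : forall f : fsym L, ('I_(farity f) -> carrier) -> carrier;
  rel_interp : forall r : rsym L, ('I_(rarity r) -> carrier) -> Prop }.

Definition env_cons (T : Type) (n : nat) (x : T) (e : 'I_n -> T)
    (i : 'I_n.+1) : T :=
  if unlift ord0 i is Some j then e j else x.

Fixpoint eval (L : signature) (M : structure L) (n : nat) (e : 'I_n -> M)
    (t : term L n) : M :=
  match t with
  | Var i => e i
  | App f a => fun_interp (fun i => eval e (a i))
  end.

Fixpoint sat (L : signature) (M : structure L) (n : nat) (phi : formula L n) :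
    ('I_n -> M) -> Prop :=
  match phi in formula _ n return ('I_n -> M) -> Prop with
  | FFalse _ => fun _ => False
  | FEq _ t u => fun e => eval e t = eval e u
  | FRel _ r a => fun e => rel_interp (fun i => eval e (a i))
  | FImp _ phi psi => fun e => sat phi e -> sat psi e
  | FAnd _ phi psi => fun e => sat phi e /\ sat psi e
  | FOr _ phi psi => fun e => sat phi e \/ sat psi e
  | FAll _ phi => fun e => forall x : M, sat phi (env_cons x e)
  | FEx _ phi => fun e => exists x : M, sat phi (env_cons x e)
  end.

Definition empty_env (T : Type) (i : 'I_0) : T :=
  False_rect T (notF (ltn_ord i)).

Definition holds (L : signature) (M : structure L) (phi : sentence L) : Prop :=
  sat phi (@empty_env M).

Definition elem_equiv (L : signature) (M N : structure L) : Prop :=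
  forall phi : sentence L, holds M phi <-> holds N phi.

Inductive ring_fsym := RZero | ROne | ROpp | RAdd | RMul.

Definition ring_farity (f : ring_fsym) : nat :=
  match f with
  | RZero | ROne => 0
  | ROpp => 1
  | RAdd | RMul => 2
  end.

Definition ring_sig : signature :=
  @Signature ring_fsym ring_farity void (fun _ => 0).

Definition order_sig : signature :=
  @Signature void (fun _ => 0) unit (fun _ => 2).

Local Open Scope ring_scope.

Definition ring_fun_interp (R : pzRingType) (f : ring_fsym) :
    ('I_(ring_farity f) -> R) -> R :=
  match f with
  | RZero => fun _ => 0
  | ROne => fun _ => 1
  | ROpp => fun a => - a ord0
  | RAdd => fun a => a ord0 + a ord_max
  | RMul => fun a => a ord0 * a ord_max
  end.

Definition ring_structure (R : pzRingType) : structure ring_sig :=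
  @Structure ring_sig R (@ring_fun_interp R) (fun r _ => match r with end).

Definition order_structure (T : Type) (le : T -> T -> Prop) :
    structure order_sig :=
  @Structure order_sig T (fun f _ => match f with end)
    (fun _ a => le (a ord0) (a ord_max)).

Section Endomorphisms.
Context {R : pzRingType} (V : lmodType R).

Definition endo : Type := {linear V -> V}.

HB.instance Definition _ := gen_eqMixin endo.
HB.instance Definition _ := gen_choiceMixin endo.

Lemma endoP (f g : {linear V -> V}) : f =1 g -> f = g :> endo.
Proof.
move: f g => [f [[f0] [fZ]]] [g [[g0] [gZ]]] /= /funext fg.
case: _ / fg g0 gZ => g0 gZ.
by rewrite (Prop_irrelevance f0 g0) (Prop_irrelevance fZ gZ).
Qed.

Definition endo_zero : endo := (\0 : {linear V -> V}).
Definition endo_opp (f : endo) : endo :=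
  (\- (f : {linear V -> V}) : {linear V -> V}).
Definition endo_add (f g : endo) : endo :=
  ((f : {linear V -> V}) \+ (g : {linear V -> V}) : {linear V -> V}).
Definition endo_one : endo := (idfun : {linear V -> V}).
Definition endo_mul (f g : endo) : endo :=
  ((f : {linear V -> V}) \o (g : {linear V -> V}) : {linear V -> V}).

Lemma endo_addA : associative endo_add.
Proof. by move=> f g h; apply: endoP => x /=; rewrite addrA. Qed.
Lemma endo_addC : commutative endo_add.
Proof. by move=> f g; apply: endoP => x /=; rewrite addrC. Qed.
Lemma endo_add0 : left_id endo_zero endo_add.
Proof. by move=> f; apply: endoP => x /=; rewrite add0r. Qed.
Lemma endo_addN : left_inverse endo_zero endo_opp endo_add.
Proof. by move=> f; apply: endoP => x /=; rewrite addNr. Qed.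

HB.instance Definition _ :=
  GRing.isZmodule.Build endo endo_addA endo_addC endo_add0 endo_addN.

Lemma endo_mulA : associative endo_mul.
Proof. by move=> f g h; apply: endoP. Qed.
Lemma endo_mul1f : left_id endo_one endo_mul.
Proof. by move=> f; apply: endoP. Qed.
Lemma endo_mulf1 : right_id endo_one endo_mul.
Proof. by move=> f; apply: endoP. Qed.
Lemma endo_mulDl : left_distributive endo_mul +%R.
Proof. by move=> f g h; apply: endoP. Qed.
Lemma endo_mulDr : right_distributive endo_mul +%R.
Proof.
move=> f g h; apply: endoP => x.
exact: (linearD (f : {linear V -> V})).
Qed.

HB.instance Definition _ := GRing.Zmodule_isPzRing.Build endo
  endo_mulA endo_mul1f endo_mulf1 endo_mulDl endo_mulDr.

End Endomorphisms.

Section Modules.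
Context {R : pzRingType} (V : lmodType R).

Definition is_submodule (N : set V) : Prop := submod_closed [in N].

Definition submodule : Type := {N : set V | is_submodule N}.

Definition submodule_structure : structure order_sig :=
  order_structure (fun M N : submodule => sval M `<=` sval N).

Definition generates (A N : set V) : Prop := smallest is_submodule A = N.

(* Families rather than subsets of V; over a nonzero ring an independent family
   is injective. *)
Definition lin_indep (K : Type) (e : K -> V) : Prop :=
  forall (n : nat) (k : 'I_n -> K) (a : 'I_n -> R), injective k ->
    \sum_(i < n) a i *: e (k i) = 0 -> forall i, a i = 0.

Definition is_basis (K : Type) (e : K -> V) : Prop :=
  lin_indep e /\ generates (range e) [set: V].

(* Cardinal numbers are represented by types: K stands for its cardinality. *)
Definition free_of_rank (K : Type) : Prop := exists e : K -> V, is_basis e.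

Definition generated_by_at_most (K : Type) (N : set V) : Prop :=
  exists A : set V, (A #<= [set: K])%card /\ generates A N.

End Modules.

(* Main.v *)
Require Import Defs.
From HB Require Import structures.
From mathcomp Require Import all_boot all_algebra.
From mathcomp Require Import boolp classical_sets functions cardinality.

(** Under the hypotheses the submodules of V are exactly the images of its
    endomorphisms: N is the image of a map sending the basis onto generators of
    N. As V is projective, the image of f lies in that of g if and only if
    f = g h for some endomorphism h. Thus P(V) is interpreted in End(V) by a
    translation of formulas that does not depend on V. *)

Set Implicit Arguments.
Unset Strict Implicit.
Unset Printing Implicit Defensive.

Import GRing.Theory.

Local Open Scope ring_scope.
Local Open Scope classical_set_scope.

(** * Translating order formulas into ring formulas *)

Definition var_of n (t : term order_sig n) : 'I_n :=
  match t with
  | Var i => i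
  | App f _ => match f with end
  end.

(** In an endomorphism ring this will express that the image of variable [i] lies in the image of
    variable [j]. The quotient is the bound variable 0, hence the lifts. *)
Definition right_multiple n (i j : 'I_n) : formula ring_sig n :=
  FEx (FEq (Var ring_sig (lift ord0 i))
    (@App ring_sig _ RMul
       (fun k : 'I_2 => if k == ord0 then Var ring_sig (lift ord0 j)
                        else Var ring_sig ord0))).

(** Distinct ring elements may code the same element of the order, so equality becomes divisibility
    both ways. Every ring element is a code, so quantifiers are not relativized. *)
Fixpoint translate n (phi : formula order_sig n) : formula ring_sig n :=
  match phi in formula _ n return formula ring_sig n with
  | FFalse n => FFalse ring_sig n
  | FEq _ t u => FAnd (right_multiple (var_of t) (var_of u))
                      (right_multiple (var_of u) (var_of t))
  | FRel _ _ a => right_multiple (var_of (a ord0)) (var_of (a ord_max))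
  | FImp _ phi psi => FImp (translate phi) (translate psi)
  | FAnd _ phi psi => FAnd (translate phi) (translate psi)
  | FOr _ phi psi => FOr (translate phi) (translate psi)
  | FAll _ phi => FAll (translate phi)
  | FEx _ phi => FEx (translate phi)
  end.

Lemma env_cons_lift (T : Type) n (x : T) (e : 'I_n -> T) i :
  env_cons x e (lift ord0 i) = e i.
Proof. by rewrite /env_cons liftK. Qed.

Lemma env_cons_ord0 (T : Type) n (x : T) (e : 'I_n -> T) :
  env_cons x e ord0 = x.
Proof. by rewrite /env_cons unlift_none. Qed.

Lemma comp_env_cons (T U : Type) (p : T -> U) n (x : T) (e : 'I_n -> T) :
  p \o env_cons x e = env_cons (p x) (p \o e).
Proof. by apply/funext => i; rewrite /= /env_cons; case: unlift. Qed.

Lemma sat_right_multiple (E : pzRingType) n (i j : 'I_n) (e : 'I_n -> E) :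
  sat (M := ring_structure E) (right_multiple i j) e <->
  exists h : E, e i = e j * h.
Proof.
by split=> -[h /= eij]; exists h; move: eij;
  rewrite /= ?env_cons_lift ?env_cons_ord0.
Qed.

Lemma eval_var_of (T : Type) (le : T -> T -> Prop) n (e : 'I_n -> T)
    (t : term order_sig n) :
  eval (M := order_structure le) e t = e (var_of t).
Proof. by case: t => // -[]. Qed.

(** * Correctness of the translation for an abstract coding [p] *)

Section Interpretation.
Variables (E : pzRingType) (T : Type) (le : T -> T -> Prop) (p : E -> T).
Hypothesis le_refl : forall x, le x x.
Hypothesis le_anti : forall x y, le x y -> le y x -> x = y.
Hypothesis p_surj : forall y, exists x, p x = y.
Hypothesis p_le : forall f g, le (p f) (p g) <-> exists h, f = g * h.

(** Induction on [phi]: [p_le] and antisymmetry settle the atoms, and surjectivity of [p] makes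
    quantifying over codes the same as quantifying over [T]. *)
Lemma sat_translate n (phi : formula order_sig n) (e : 'I_n -> E) :
  sat (M := ring_structure E) (translate phi) e <->
  sat (M := order_structure le) phi (p \o e).
Proof.
elim: phi e => {n}
  [n|n t u|n r a|n f IHf g IHg|n f IHf g IHg|n f IHf g IHg|n f IHf|n f IHf] e.
- by [].
- rewrite [sat (FEq _ _) _]/= !eval_var_of.
  split=> [[/sat_right_multiple/p_le ? /sat_right_multiple/p_le ?]|/= eq_tu].
    exact: le_anti.
  by split; apply/sat_right_multiple/p_le; rewrite eq_tu.
- rewrite [sat (FRel _) _]/= !eval_var_of [translate _]/=.
  by rewrite sat_right_multiple -p_le.
- by move: (IHf e) (IHg e) => /=; tauto.
- by move: (IHf e) (IHg e) => /=; tauto.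
- by move: (IHf e) (IHg e) => /=; tauto.
- split=> /= H x.
    have [y <-] := p_surj x.
    by rewrite -comp_env_cons -IHf.
  by rewrite IHf comp_env_cons.
- split=> /= -[x H].
    by exists (p x); rewrite -comp_env_cons -IHf.
  have [y yx] := p_surj x.
  by exists y; rewrite IHf comp_env_cons yx.
Qed.

Lemma holds_translate (phi : sentence order_sig) :
  holds (ring_structure E) (translate phi) <-> holds (order_structure le) phi.
Proof.
rewrite /holds sat_translate.
by have -> : p \o @empty_env E = @empty_env T by apply/funext => -[].
Qed.

End Interpretation.

(** * Linear combinations and linear extension from a basis *)

Section Combinations.
Context {R : pzRingType} {V : lmodType R}.

(** Indices may repeat in [s], so that concatenation represents addition. *)
Definition combination {K : Type} (e : K -> V) (s : seq (R * K)) : V :=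
  \sum_(p <- s) p.1 *: e p.2.

Lemma combination_cat (K : Type) (e : K -> V) s t :
  combination e (s ++ t) = combination e s + combination e t.
Proof. exact: big_cat. Qed.

Lemma combination_scale (K : Type) (e : K -> V) a s :
  combination e [seq (a * p.1, p.2) | p <- s] = a *: combination e s.
Proof.
by rewrite /combination big_map scaler_sumr; under eq_bigr do rewrite -scalerA.
Qed.

Lemma combination_collect (K : eqType) (e : K -> V) s :
  combination e s = \sum_(c <- undup [seq p.2 | p <- s])
                      (\sum_(p <- s | p.2 == c) p.1) *: e c.
Proof.
under [RHS]eq_bigr do rewrite scaler_suml.
(* After the exchange, each pair [p] of [s] meets only the index [c = p.2], which occurs exactly
   once in the duplicate-free list. *)
rewrite (exchange_big_dep xpredT) //= /combination.
rewrite big_seq [RHS]big_seq; apply: eq_bigr => p ps.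
under eq_bigl do rewrite eq_sym.
rewrite -big_filter filter_pred1_uniq ?big_seq1 ?undup_uniq //.
by rewrite mem_undup map_f.
Qed.

(** Once equal indices are collected, independence kills every coefficient, and the coefficients
    depend on [s] alone, not on the family. *)
Lemma combination_eq0 (K : Type) (e u : K -> V) s :
  lin_indep e -> combination e s = 0 -> combination u s = 0.
Proof.
move=> indep.
rewrite !(@combination_collect {classic K}) => es0.
set a := fun c : {classic K} =>
  \sum_(p <- s | (p.2 : {classic K}) == c) p.1 in es0 *.
set r := undup _ in es0 *.
suff a0 c : c \in r -> a c = 0.
  by rewrite big_seq big1 // => c /a0 ac0; rewrite -/(a c) ac0 scale0r.
move=> cr; have i_lt : (index c r < size r)%N by rewrite index_mem.
(* [k] enumerates the distinct indices of [s], as [lin_indep] requires. *)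
pose k (i : 'I_(size r)) : K := nth c r i.
have k_inj : injective k.
  move=> i j kij; apply/val_inj/eqP.
  by rewrite -(nth_uniq c (ltn_ord i) (ltn_ord j) (undup_uniq _)); apply/eqP.
have <- : k (Ordinal i_lt) = c by exact: (nth_index c cr).
apply: (indep _ k (fun i => a (k i)) k_inj).
by rewrite -[RHS]es0 (big_nth c) big_mkord.
Qed.

(** Write [x] as some combination of [e] and replace [e] by [u]; by [combination_eq0] the value does
    not depend on the choice, which also gives linearity. *)
Lemma linear_extension (K : Type) (e u : K -> V) :
  is_basis e -> exists f : endo V, forall k, f (e k) = u k.
Proof.
move=> [indep gen].
have span x : exists s, combination e s = x.
  have : [set: V] x by [].
  rewrite -gen => /(_ [set x | exists s, combination e s = x]); apply; split.
    split=> [|a y z]; rewrite !inE /=.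
      by exists [::]; rewrite /combination big_nil.
    move=> [s <-] [t <-]; exists ([seq (a * p.1, p.2) | p <- s] ++ t).
    by rewrite combination_cat combination_scale.
  move=> _ [k _ <-]; exists [:: (1, k)].
  by rewrite /combination big_seq1 scale1r.
have [c cE] := choice span.
have uniq_value s t :
    combination e s = combination e t -> combination u s = combination u t.
  (* The difference of the two values is the value of [s] followed by [t] scaled by -1, a
     combination that vanishes on [e]. *)
  move=> est; apply/eqP; rewrite -subr_eq0 -scaleN1r -combination_scale.
  rewrite -combination_cat (combination_eq0 _ indep) //.
  by rewrite combination_cat combination_scale scaleN1r est subrr.
pose f x := combination u (c x).
have f_lin : linear f.
  move=> a x y; rewrite /f -combination_scale -combination_cat.
  by apply: uniq_value; rewrite combination_cat combination_scale !cE.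
pose F := GRing.isLinear.Build R V V *:%R f f_lin.
pose g : {linear V -> V} := HB.pack f F.
exists g => k; rewrite /= /f (@uniq_value _ [:: (1, k)]).
  by rewrite /combination big_seq1 scale1r.
by rewrite cE /combination big_seq1 scale1r.
Qed.

End Combinations.

(** * Submodules as images of endomorphisms *)

Section Images.
Context {R : pzRingType} {V : lmodType R}.

Lemma is_submodule_range (f : endo V) : is_submodule (range f).
Proof.
split=> [|a x y]; rewrite !inE; first by exists 0; rewrite ?linear0.
by move=> [x' _ <-] [y' _ <-]; exists (a *: x' + y'); rewrite ?linearP.
Qed.

Definition image (f : endo V) : submodule V := exist _ _ (is_submodule_range f).

Lemma submodule_le_anti (M N : submodule V) :
  sval M `<=` sval N -> sval N `<=` sval M -> M = N.
Proof.
by case: M N => [M M_sub] [N N_sub] /= MN NM; apply: eq_exist; apply/seteqP.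
Qed.

Variables (K : Type) (e : K -> V).
Hypothesis e_basis : is_basis e.

(** Lets a property that defines a submodule be checked on basis vectors only. *)
Lemma is_submodule_full (N : set V) :
  is_submodule N -> range e `<=` N -> forall x, N x.
Proof.
move=> N_sub eN x; have : [set: V] x by [].
by rewrite -(proj2 e_basis); apply.
Qed.

(** Projectivity: [h] sends each [e k] to a chosen preimage under [g] of [f (e k)], so [f] and
    [g * h] agree on the basis. *)
Lemma image_le (f g : endo V) :
  sval (image f) `<=` sval (image g) <-> exists h, f = g * h.
Proof.
split=> [fg|[h ->] _ [x _ <-]]; last by exists (h x).
have preimage k : exists y, g y = f (e k).
  have [|y _ <-] := fg (f (e k)); first by exists (e k).
  by exists y.
have [u uE] := choice preimage; have [h hE] := linear_extension u e_basis.
exists h; apply: endoP => x.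
apply: (is_submodule_full (N := [set x | f x = (g * h) x])) => [|_ [k _ <-]].
  split=> [|a y z]; rewrite !inE /= ?linear0 // => fy fz.
  by rewrite !linearP fy fz.
by rewrite /= hE uE.
Qed.

Lemma image_surj (N : submodule V) :
  generated_by_at_most K (sval N) -> exists f, image f = N.
Proof.
case: N => N N_sub [A [/card_leP[j] A_gen]] /=.
have AN : A `<=` N by rewrite -[N]A_gen; apply: sub_gen_smallest.
(* The injection [j] labels generators by basis indices: [e k] is to go to the generator labelled
   [k], or to 0 if there is none. *)
have pick k : exists y, N y /\ forall x : A, val (j x) = k -> y = val x.
  have [[x jx]|no] := pselect (exists x : A, val (j x) = k).
    exists (val x); split=> [|y jy]; first by apply: AN; apply: set_valP.
    congr val; apply: (@inj _ _ _ j); rewrite ?inE //.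
    by apply: val_inj; rewrite jx.
  exists 0; split=> [|x jx]; last by case: no; exists x.
  by have /set_mem := proj1 N_sub.
have [u uE] := choice pick; have [f fE] := linear_extension u e_basis.
exists f; apply: submodule_le_anti => /=.
  move=> _ [x _ <-].
  apply: (is_submodule_full (N := [set x | N (f x)])) => [|_ [k _ <-]].
    split=> [|a y z]; rewrite !inE /= ?linear0 ?linearP.
      by have /set_mem := proj1 N_sub.
    by move=> Ny Nz; apply/set_mem; apply: (proj2 N_sub); rewrite inE.
  by rewrite /= fE; apply: (uE k).1.
(* [N] is the smallest submodule containing [A], and each generator [x] is the value of [f] at the
   basis vector labelled by [j x]. *)
rewrite -[X in X `<=` _]A_gen; apply: smallest_sub.
  exact: is_submodule_range.
move=> x Ax; pose x' : A := SigSub (mem_set Ax).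
by exists (e (val (j x'))); rewrite // fE ((uE _).2 x').
Qed.

Hypothesis V_gen : forall N : set V, is_submodule N -> generated_by_at_most K N.

Lemma holds_submodules (phi : sentence order_sig) :
  holds (ring_structure (endo V)) (translate phi) <->
  holds (submodule_structure V) phi.
Proof.
apply: (holds_translate (p := image)) => [N|M N|N|f g].
- exact: subset_refl.
- exact: submodule_le_anti.
- by apply: image_surj; apply: V_gen; apply: (svalP N).
- exact: image_le.
Qed.

End Images.

Theorem theorem13 (R1 R2 : pzRingType) (V1 : lmodType R1) (V2 : lmodType R2)
    (K1 K2 : Type)
    (K1_infinite : infinite_set [set: K1]%classic)
    (K2_infinite : infinite_set [set: K2]%classic)
    (V1_free : free_of_rank V1 K1)
    (V2_free : free_of_rank V2 K2)
    (V1_gen : forall N : set V1, is_submodule N -> generated_by_at_most K1 N)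
    (V2_gen : forall N : set V2, is_submodule N -> generated_by_at_most K2 N) :
  elem_equiv (ring_structure (endo V1)) (ring_structure (endo V2)) ->
  elem_equiv (submodule_structure V1) (submodule_structure V2).
Proof.
case: V1_free V2_free => [e1 e1_basis] [e2 e2_basis] equiv phi.
(* Both sides become the truth of the same ring sentence [translate phi], in the two endomorphism
   rings. *)
rewrite -(holds_submodules e1_basis V1_gen).
by rewrite -(holds_submodules e2_basis V2_gen).
Qed.
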